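(* Let $(\boldsymbol{\nu},\mathbf{G},T)$ be an instance of Rising Graph-Triggered Bandits with $k$ arms, where $\mathbf{G}\in\mathbb{B}_{\widetilde k}$ is a block-diagonal connectivity matrix with clique partition $\mathcal{C}=\mathcal{C}_{\mathbf{G}}$ and $\sigma=0$ (deterministic rewards). Then the algorithm DR-BD-UB suffers a regret bounded by $$R_{\boldsymbol{\nu},\mathbf{G},T}(\text{DR-BD-UB})\le\widetilde{\mathcal{O}}\Bigg(\inf_{q\in[0,1]}\Bigg\{T^q\sum_{C_m\in\mathcal{C}}|C_m|\,\Upsilon_{\boldsymbol{\nu}}\Big(\Big\lceil\tfrac{\widetilde N_{C_m,T}}{|C_m|}\Big\rceil,q\Big)+\sum_{C_m\in\mathcal{C}}|C_m|\,\widetilde N_{C_m,T}^{\frac{q}{1+q}}\,\Upsilon_{\boldsymbol{\nu}}\Big(\Big\lceil\tfrac{\widetilde N_{C_m,T}}{|C_m|}\Big\rceil,q\Big)^{\frac{1}{1+q}}\Bigg\}\Bigg),$$ where $\widetilde N_{C_m,T}$ is the number of rounds up to $T$ in which DR-BD-UB pulls an arm of $C_m$.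
   Context: Graph-Triggered Bandits (GTB): there are $k$ arms, a horizon $T\in\mathbb{N}$, and a symmetric connectivity matrix $\mathbf{G}\in\{0,1\}^{k\times k}$ with $\mathbf{G}_{i,i}=1$ for all $i\in[k]$. At each round $t\in[T]$ the agent selects an arm $I_t$ based on the past history. Let $N_{i,t}=\sum_{\tau\le t}\mathbf{1}\{I_\tau=i\}$ (pulls) and $\widetilde N_{i,t}=\sum_{\tau\le t}\mathbf{1}\{\mathbf{G}_{I_\tau,i}=1\}$ (triggers). In the deterministic case $\sigma=0$ the agent receives and observes exactly $\mu_{I_t}(\widetilde N_{I_t,t})\in[0,1]$. Performance: $J_{\boldsymbol{\nu},\mathbf{G},T}(\pi)=\mathbb{E}[\sum_{t=1}^T\mu_{I_t}(\widetilde N_{I_t,t})]$; regret: $R_{\boldsymbol{\nu},\mathbf{G},T}(\pi)=\max_{\pi'}J_{\boldsymbol{\nu},\mathbf{G},T}(\pi')-J_{\boldsymbol{\nu},\mathbf{G},T}(\pi)$. Rising: with $\gamma_i(n)=\mu_i(n+1)-\mu_i(n)$, for all $i,n$: $\gamma_i(n)\ge0$ and $\gamma_i(n-1)\ge\gamma_i(n)$. Total increment: $\Upsilon_{\boldsymbol{\nu}}(M,q)=\sum_{t=1}^{M-1}\max_{i\in[k]}\gamma_i(t)^q$ for $M\in\mathbb{N}$, $q\in[0,1]$. $\mathbf{G}\in\mathbb{B}_{\widetilde k}$ means: there is a partition $\mathcal{C}_{\mathbf{G}}$ of $[k]$ into $\widetilde k$ classes (cliques) such that $\mathbf{G}_{i,j}=1$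 iff $i,j$ are in the same class. $\widetilde N_{C_m,t}=\sum_{i\in C_m}N_{i,t}$. Internal times: $t_{i,n}$ is the round at which arm $i$ is pulled for the $n$-th time and $t^I_{i,n}=\widetilde N_{i,t_{i,n}}$. Algorithm DR-BD-UB (input $\mathbf{G}$): first play each arm twice in round-robin; afterwards at each round $t$ play $I_t\in\arg\max_{i\in[k]}\bar\mu_i(t)$, where, writing $N=N_{i,t-1}$, $$\bar\mu_i(t)=\mu_i(t^I_{i,N})+(t-t^I_{i,N})\frac{\mu_i(t^I_{i,N})-\mu_i(t^I_{i,N-1})}{t^I_{i,N}-t^I_{i,N-1}}.$$ $\widetilde{\mathcal{O}}(\cdot)$ is the standard soft-O notation, hiding numerical constants and logarithmic factors; the dependence on the clique sizes $|C_m|$ is the one displayed.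
   Formalization: The bound fails as stated (two constant arms 1 and 0, G the identity: the bracket is 0 but regret is 2), so 2k for the forced pulls is added; the bound without this term is proved when T ≥ 2k and T·γ_i(1) ≥ 1 for some arm i. *)

(* Defs.v *)
From HB Require Import structures.
From mathcomp Require Import all_boot all_order all_algebra.
From mathcomp Require Import all_classical all_reals all_analysis.

Set Implicit Arguments.
Unset Strict Implicit.
Unset Printing Implicit Defensive.

Import Order.TTheory GRing.Theory Num.Theory.

Local Open Scope ring_scope.

(* Sequences of arms and histories are chronological: the arm of round
   t = 1, 2, ... is at position t - 1. *)

Section GraphTriggeredBandits.
Context {R : realType} {k : nat}.
Implicit Types (G : 'M[bool]_k) (mu : 'I_k -> nat -> R) (a : seq 'I_k).
Implicit Types (h : seq ('I_k * R)) (i : 'I_k) (q : R) (C : {set 'I_k}).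

Definition connectivity G := G^T = G /\ forall i, G i i.

(* G \in B_kt, with clique partition P. *)
Definition block_diagonal kt G (P : {set {set 'I_k}}) :=
  [/\ finset.partition P [set: 'I_k], #|P| = kt &
      forall i j, G i j <-> exists2 C, C \in P & i \in C /\ j \in C].

(* mu i n is only meaningful for n >= 1: an arm that is pulled has been
   triggered at least once. The value mu i 0 is unconstrained and unused. *)
Definition unit_rewards mu := forall i n, (0 < n)%N -> 0 <= mu i n <= 1.

Definition gamma mu i n : R := mu i n.+1 - mu i n.

Definition rising mu :=
  (forall i n, (0 < n)%N -> 0 <= gamma mu i n) /\
  (forall i n, (1 < n)%N -> gamma mu i n <= gamma mu i n.-1).

(* powR satisfies 0 `^ 0 = 1. The default 0 of the maximum is neutral because
   all the terms are nonnegative. *)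
Definition Upsilon mu (M : nat) q : R :=
  \sum_(1 <= t < M) \big[Num.max/0]_(i < k) (gamma mu i t `^ q).

(* N_{i,t}, \tilde N_{i,t} and N_{C,t} for t = size a. *)
Definition pulls a i : nat := count_mem i a.
Definition triggers G a i : nat := count (fun j => G j i) a.
Definition clique_pulls a C : nat := \sum_(i in C) pulls a i.

(* t_{i,n}: the first t such that arm i is pulled n times in rounds 1..t. *)
Definition pull_round a i n : nat :=
  find (fun t => pulls (take t a) i == n) (iota 0 (size a).+1).

Definition internal_time G a i n : nat :=
  triggers G (take (pull_round a i n) a) i.

(* A policy maps the past arms and observed rewards to the next arm. *)
Definition policy := seq ('I_k * R) -> 'I_k.
Implicit Type pol : policy.

Fixpoint history mu G pol (t : nat) : seq ('I_k * R) :=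
  if t is t'.+1 then
    let h := history mu G pol t' in
    let i := pol h in
    rcons h (i, mu i (triggers G (rcons (unzip1 h) i) i))
  else [::].

Definition arms mu G pol t : seq 'I_k := unzip1 (history mu G pol t).

(* With deterministic rewards and policies the expectation is over a point
   mass. *)
Definition J mu G pol (T : nat) : R := \sum_(x <- history mu G pol T) x.2.

(* For fixed T, J takes finitely many values, so the supremum is a maximum. *)
Definition regret mu G pol (T : nat) : R :=
  sup (range (fun pol' : policy => J mu G pol' T)) - J mu G pol T.

Definition observed_reward h i n : R :=
  nth 0 (unzip2 h) (pull_round (unzip1 h) i n).-1.

(* The index of arm i at round t = size h + 1, computed from observations
   only: the n-th observed reward of arm i is mu i (internal_time _ _ i n). *)
Definition ucb_index G h i : R :=
  let t := (size h).+1 in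
  let N := pulls (unzip1 h) i in
  let x := observed_reward h i in
  let tI n : R := (internal_time G (unzip1 h) i n)%:R in
  x N + (t%:R - tI N) * ((x N - x N.-1) / (tI N - tI N.-1)).

(* Ties in the argmax may be broken in any way. *)
Definition DR_BD_UB G pol := forall h,
  if (size h < 2 * k)%N then val (pol h) = (size h %% k)%N
  else forall j, ucb_index G h j <= ucb_index G h (pol h).

Definition clique_Upsilon mu a C q : R :=
  Upsilon mu `|Num.ceil ((clique_pulls a C)%:R / #|C|%:R : R)|%N q.

Definition rate mu (P : {set {set 'I_k}}) a (T : nat) q : R :=
  T%:R `^ q * (\sum_(C in P) #|C|%:R * clique_Upsilon mu a C q) +
  \sum_(C in P) #|C|%:R * (clique_pulls a C)%:R `^ (q / (1 + q))
                * clique_Upsilon mu a C q `^ (1 / (1 + q)).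

Definition regret_rate mu G (P : {set {set 'I_k}}) pol (T : nat) : R :=
  inf [set rate mu P (arms mu G pol T) T q | q in [set q : R | 0 <= q <= 1]]%classic.

End GraphTriggeredBandits.

Arguments policy R k : clear implicits.

(* What a soft-O of x stands for, given its numerical constant c and its
   logarithmic exponent p. *)
Definition soft_O {R : realType} (c : R) (p T : nat) (x : R) : R :=
  c * (1 + ln T%:R) ^+ p * x.

(* Main.v *)
(* By concavity the index of an arm at round t dominates its reward mu_i(t), so
   it dominates whatever a competitor can earn at round t. When arm i is played
   for the n-th time, n >= 3, the gap between its index and its reward is at
   most T times the chord slope starting at the (n-2)-th pull of i, hence at
   most T * gamma_i(n-2), because an internal time is at least the number of
   pulls. As the gap is also at most 1, it is at most (T * gamma_i(n-2))^q.
   Summing over the pulls of i gives T^q * Upsilon(N_i - 1, q), and concavity of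
   M |-> Upsilon(M, q) balances the pulls inside each clique (Jensen). The first
   summand of the rate thus suffices, with no logarithm. The 2k forced pulls
   cost at most 2k; every clique has ceil(N_C / |C|) >= 2 afterwards, so this is
   at most twice the rate as soon as T * gamma_i(1) >= 1 for some i. *)
Require Import Defs.
From mathcomp Require Import all_boot all_order all_algebra.
From mathcomp Require Import all_classical all_reals all_analysis.
From mathcomp Require Import zify lra.
Import Order.TTheory GRing.Theory Num.Theory.
Local Open Scope ring_scope.

(** * Inequalities for sequences with nonincreasing increments *)

Section ConcaveSums.
Context {R : realType}.
Implicit Types (f g : nat -> R).

Lemma increments_nonincreasing f :
  (forall n, (1 < n)%N -> f n.+1 - f n <= f n.-1.+1 - f n.-1) ->
  forall m n, (0 < m <= n)%N -> f n.+1 - f n <= f m.+1 - f m.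
Proof.
move=> fdec m n /andP[m0]; elim: n => [|n IHn]; first by case: m m0.
rewrite leq_eqVlt => /orP[/eqP <- //|]; rewrite ltnS => mn.
by apply: le_trans (fdec n.+1 _) (IHn mn); rewrite ltnS (leq_trans m0 mn).
Qed.

(** The partial sums of [g] are concave in their upper end, and the right-hand side is their tangent
    at [M]: terms from [M] on are at most [g M], earlier ones at least [g M]. *)
Lemma sum_tangent g (a M : nat) :
  (forall m n, (0 < m <= n)%N -> g n <= g m) -> (0 < a)%N -> (0 < M)%N ->
  \sum_(1 <= n < a) g n <= \sum_(1 <= n < M) g n + (a%:R - M%:R) * g M.
Proof.
move=> gdec a0 M0; have [Ma|aM] := leqP M a.
  rewrite (big_cat_nat (n := M)) //= lerD2l -natrB // mulr_natl -sumr_const_nat.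
  by rewrite ler_sum_nat // => n /andP[Mn _];
    apply: gdec; rewrite M0.
rewrite [X in _ <= X + _](big_cat_nat (n := a)) ?(ltnW aM) //= -addrA lerDl.
rewrite -opprB mulNr subr_ge0 -natrB ?(ltnW aM) // mulr_natl -sumr_const_nat.
rewrite ler_sum_nat // => n /andP[an nM].
by apply: gdec; rewrite (leq_trans a0 an) ltnW.
Qed.

(** All tangents are taken at the same [M], so their linear parts add up to a nonpositive multiple
    of [g M]. Only an upper bound [M] on the average of [N] is required, which leaves room for a
    ceiling. *)
Lemma jensen_sum (I : finType) (C : {set I}) g (N : I -> nat) (M : nat) :
  (forall m n, (0 < m <= n)%N -> g n <= g m) -> (forall n, 0 <= g n) ->
  (forall i, 0 < N i)%N -> (0 < M)%N -> (\sum_(i in C) N i <= #|C| * M)%N ->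
  \sum_(i in C) \sum_(1 <= n < N i) g n <= #|C|%:R * \sum_(1 <= n < M) g n.
Proof.
move=> gdec g0 N0 M0 NM.
apply: (@le_trans _ _ (\sum_(i in C)
    (\sum_(1 <= n < M) g n + ((N i)%:R - M%:R) * g M))).
  by apply: ler_sum => i _; apply: sum_tangent.
rewrite big_split /= sumr_const mulr_natl gerDl -mulr_suml mulr_le0_ge0 //.
by rewrite sumrB sumr_const -natr_sum -mulrnA mulnC subr_le0 ler_nat.
Qed.

(** The chord slope is the mean of the increments at [a], ..., [b.-1]. It therefore lies between the
    increment at [b.-1], which dominates all increments from [b] on, and the increment at [a]. *)
Lemma chord_bounds f (a b t : nat) :
  (forall m n, (0 < m <= n)%N -> f n.+1 - f n <= f m.+1 - f m) ->
  (0 < a)%N -> (a < b)%N -> (b <= t)%N ->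
  f t <= f b + (t%:R - b%:R) * ((f b - f a) / (b%:R - a%:R)) /\
  (f b - f a) / (b%:R - a%:R) <= f a.+1 - f a.
Proof.
move=> fdec a0 ab bt.
have ba0 : 0 < b%:R - a%:R :> R by rewrite subr_gt0 ltr_nat.
have tele m n : (m <= n)%N -> f n - f m = \sum_(m <= s < n) (f s.+1 - f s).
  by move=> mn; rewrite telescope_sumr.
have b0 : (0 < b)%N by apply: leq_ltn_trans ab.
have lo : (b%:R - a%:R) * (f b.-1.+1 - f b.-1) <= f b - f a.
  rewrite (tele a b) ?(ltnW ab) // -natrB ?(ltnW ab) // mulr_natl -sumr_const_nat.
  rewrite ler_sum_nat // => n /andP[an nb].
  by apply: fdec; lia.
have hi : f t - f b <= (t%:R - b%:R) * (f b.-1.+1 - f b.-1).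
  rewrite (tele b t) // -natrB // mulr_natl -sumr_const_nat.
  rewrite ler_sum_nat // => n /andP[bn nt].
  by apply: fdec; lia.
split.
  rewrite -lerBlDl (le_trans hi) // ler_wpM2l ?subr_ge0 ?ler_nat //.
  by rewrite ler_pdivlMr // mulrC.
rewrite ler_pdivrMr // mulrC (tele a b) ?(ltnW ab) // -natrB ?(ltnW ab) //.
rewrite mulr_natl -sumr_const_nat.
rewrite ler_sum_nat // => n /andP[an nb].
by apply: fdec; lia.
Qed.

Lemma powR_ge1 (x q : R) : 0 <= q -> 1 <= x -> 1 <= x `^ q.
Proof.
move=> q0 x1; have <- : 1 `^ q = 1 :> R by rewrite powR1.
by apply: ge0_ler_powR; rewrite // nnegrE (le_trans ler01).
Qed.

Lemma le_powR_of_le1 (d x q : R) :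
  0 <= q <= 1 -> 0 <= x -> d <= 1 -> d <= x -> d <= x `^ q.
Proof.
move=> /andP[q0 q1] x0 d1 dx.
have [x1|x1] := lerP 1 x.
  by apply: le_trans d1 _; apply: powR_ge1.
(* Comparing exponents needs a positive base; for [x = 0], [d <= 0] suffices. *)
move: x0; rewrite le_eqVlt => /orP[/eqP x0|x0].
  by apply: le_trans dx _; rewrite -x0 powR_ge0.
apply: le_trans dx _; rewrite -[X in X <= _]powRr1 ?(ltW x0) //.
by apply: ger_powR; rewrite // x0 ltW.
Qed.

End ConcaveSums.

(** * Pull and trigger counts along a sequence of arms *)

Section Play.
Context {R : realType} {k : nat}.
Implicit Types (G : 'M[bool]_k) (mu : 'I_k -> nat -> R) (a : seq 'I_k).
Implicit Types (i j : 'I_k) (pol : policy R k).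

Lemma pulls_rcons a i j : pulls (rcons a j) i = (pulls a i + (j == i))%N.
Proof. by rewrite /pulls -cats1 count_cat /= addn0. Qed.

Lemma triggers_rcons G a i j : triggers G (rcons a j) i = (triggers G a i + G j i)%N.
Proof. by rewrite /triggers -cats1 count_cat /= addn0. Qed.

Lemma pulls_le_triggers G a i : G i i -> (pulls a i <= triggers G a i)%N.
Proof. by move=> Gii; apply: sub_count => j /eqP ->. Qed.

Lemma pull_roundP a i n : (0 < n <= pulls a i)%N ->
  [/\ (0 < pull_round a i n <= size a)%N,
      pulls (take (pull_round a i n) a) i = n &
      nth i a (pull_round a i n).-1 = i].
Proof.
move=> /andP[n0 na]; rewrite /pull_round.
set p := fun t => _; set r := find _ _.
(* A round raises the pull count by at most one, so no value up to [pulls a i] is skipped. *)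
have hasp : has p (iota 0 (size a).+1).
  elim/last_ind: a na @p @r => [|a j IHa]; first by rewrite leqNgt n0.
  rewrite pulls_rcons leq_eqVlt => /orP[/eqP nE|na] p r.
    apply/hasP; exists (size (rcons a j)); first by rewrite mem_iota ltnS leqnn.
    by rewrite /p take_size pulls_rcons nE.
  have /IHa /hasP[s] : (n <= pulls a i)%N by move: na; case: eqP => _; lia.
  rewrite mem_iota => /andP[_ sa] /eqP sE; apply/hasP; exists s.
    by rewrite mem_iota size_rcons; lia.
  by rewrite /p -cats1 takel_cat ?sE //; lia.
have rs : (r < (size a).+1)%N by rewrite -(size_iota 0 (size a).+1) -has_find.
have pr : pulls (take r a) i = n.
  by apply/eqP; move: (nth_find 0 hasp); rewrite -/r nth_iota.
have r0 : (0 < r)%N.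
  by rewrite lt0n; apply/eqP => r0; move: pr n0; rewrite r0 take0 => <-.
have rr : (r.-1 < r)%N by rewrite prednK.
have rI : (r.-1 < size a)%N by apply: leq_trans rr _.
split=> //; first by rewrite r0.
(* If the arm of round [r] were not [i], the prefix of length [r.-1] would already contain [n]
   pulls, against the minimality of [r]. *)
have : p r.-1 = false.
  by rewrite -(before_find 0%N rr) nth_iota ?add0n // (leq_trans rr (ltnW rs)).
rewrite /p => /negbT; apply: contraNeq => /negbTE neq; rewrite -[X in _ == X]pr.
by rewrite -[in X in _ == X](prednK r0) (take_nth i rI) pulls_rcons neq addn0.
Qed.

(** * Internal times *)

Section Internal.
Variables (G : 'M[bool]_k) (a : seq 'I_k) (i : 'I_k).
Hypothesis Gii : G i i.

Lemma internal_time_ge n : (0 < n <= pulls a i)%N -> (n <= internal_time G a i n)%N.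
Proof. by move=> /pull_roundP[_ nP _]; rewrite -[X in (X <= _)%N]nP pulls_le_triggers. Qed.

Lemma internal_time_le n : (internal_time G a i n <= triggers G a i)%N.
Proof.
by rewrite -[X in triggers G X](cat_take_drop (pull_round a i n)) /triggers
  count_cat leq_addr.
Qed.

(** Between the two rounds [i] is pulled [m - n > 0] times, and each of these pulls triggers [i]. *)
Lemma internal_time_mono n m :
  (0 < n < m)%N -> (m <= pulls a i)%N ->
  (internal_time G a i n < internal_time G a i m)%N.
Proof.
move=> /andP[n0 nm] ma; rewrite /internal_time.
have /pull_roundP[_ nP _] : (0 < n <= pulls a i)%N by lia.
have /pull_roundP[_ mP _] : (0 < m <= pulls a i)%N by lia.
move: nP mP; set r := pull_round a i n; set s := pull_round a i m => rP sP.
have [sr|rs] := leqP s r.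
  have : (pulls (take s a) i <= pulls (take r a) i)%N.
    by rewrite -(subnKC sr) takeD /pulls count_cat leq_addr.
  by rewrite rP sP leqNgt nm.
have sE : take s a = take r a ++ take (s - r) (drop r a).
  by rewrite -takeD subnKC // ltnW.
have := pulls_le_triggers G (take (s - r) (drop r a)) i Gii.
rewrite -[X in (X < _)%N]addn0 sE /triggers count_cat ltn_add2l.
by apply: leq_trans; move: sP nm; rewrite sE -rP /pulls count_cat => <-; lia.
Qed.

End Internal.

(** * Rewards collected by a policy, and monotonicity of the increments *)

Variables (G : 'M[bool]_k) (mu : 'I_k -> nat -> R).
Implicit Types (t n : nat).

Lemma arms_S pol t : arms mu G pol t.+1 = rcons (arms mu G pol t) (pol (history mu G pol t)).
Proof. by rewrite /arms /= /unzip1 map_rcons. Qed.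

Lemma size_history pol t : size (history mu G pol t) = t.
Proof. by elim: t => //= t IHt; rewrite size_rcons IHt. Qed.

Lemma size_arms pol t : size (arms mu G pol t) = t.
Proof. by rewrite size_map size_history. Qed.

Lemma J_S pol t : let i := pol (history mu G pol t) in
  J mu G pol t.+1 =
  J mu G pol t + mu i (triggers G (rcons (arms mu G pol t) i) i).
Proof. by rewrite /J /= big_rcons. Qed.

Lemma rewardE pol t p i0 : (p < t)%N ->
  nth 0 (unzip2 (history mu G pol t)) p =
  mu (nth i0 (arms mu G pol t) p)
     (triggers G (take p.+1 (arms mu G pol t)) (nth i0 (arms mu G pol t) p)).
Proof.
elim: t => // t IHt; rewrite ltnS leq_eqVlt => /orP[/eqP ->|pt].
  rewrite arms_S /= /unzip2 map_rcons !nth_rcons size_map size_history size_arms.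
  by rewrite ltnn eqxx take_oversize // size_rcons size_arms.
rewrite arms_S /= /unzip2 map_rcons !nth_rcons size_map size_history size_arms pt.
by rewrite IHt // -cats1 takel_cat // size_arms.
Qed.

(** Turns [ucb_index], which is computed from observations, into a linear extrapolation of [mu i]
    from two internal times. *)
Lemma observed_rewardE pol t i n : (0 < n <= pulls (arms mu G pol t) i)%N ->
  observed_reward (history mu G pol t) i n =
  mu i (internal_time G (arms mu G pol t) i n).
Proof.
move=> /pull_roundP[/andP[r0 rs] _ iE].
rewrite /observed_reward -/(arms mu G pol t) (rewardE _ _ _ i).
  by rewrite iE prednK.
by rewrite size_arms in rs; lia.
Qed.

Hypothesis Gdiag : forall i, G i i.
Hypothesis mu01 : unit_rewards mu.
Hypothesis mu_rising : rising mu.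

Lemma gamma_noninc i m n : (0 < m <= n)%N -> gamma mu i n <= gamma mu i m.
Proof. by apply: increments_nonincreasing => s /(mu_rising.2 i s). Qed.

Lemma mu_mono i m n : (0 < m <= n)%N -> mu i m <= mu i n.
Proof.
move=> /andP[m0 mn]; rewrite -subr_ge0 -telescope_sumr // big_nat_cond.
apply: sumr_ge0 => s /andP[/andP[ms _] _].
by apply: mu_rising.1; apply: leq_trans ms.
Qed.

Lemma reward_bounds pol t : let i := pol (history mu G pol t) in
  0 <= mu i (triggers G (rcons (arms mu G pol t) i) i) <= 1.
Proof. by apply: mu01; rewrite triggers_rcons Gdiag; lia. Qed.

Lemma J_bounds pol t : 0 <= J mu G pol t <= t%:R.
Proof.
elim: t => [|t IHt]; first by rewrite /J big_nil lexx.
case/andP: IHt => J0 Jt; have /andP[x0 x1] := reward_bounds pol t.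
by rewrite J_S -natr1 addr_ge0 // lerD.
Qed.

Definition max_increment q n : R := \big[Num.max/0]_(i < k) (gamma mu i n `^ q).

Lemma max_increment_ge0 q n : 0 <= max_increment q n.
Proof. by apply: bigmax_ge_id. Qed.

Lemma max_increment_noninc q m n :
  0 <= q -> (0 < m <= n)%N -> max_increment q n <= max_increment q m.
Proof.
move=> q0 mn; apply: le_bigmax2 => i _.
apply: ge0_ler_powR => //; rewrite ?nnegrE ?gamma_noninc //; apply: mu_rising.1; lia.
Qed.

Lemma Upsilon_ge0 M q : 0 <= Upsilon mu M q.
Proof. by apply: sumr_ge0 => n _; apply: max_increment_ge0. Qed.

(** * Regret in terms of the pulls of each arm *)

Section Algorithm.
Variable pol : policy R k.
Hypothesis polP : DR_BD_UB G pol.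

Lemma forced_arms t : (t <= 2 * k)%N ->
  [seq val i | i <- arms mu G pol t] = [seq (s %% k)%N | s <- iota 0 t].
Proof.
elim: t => // t IHt tk; rewrite arms_S map_rcons IHt ?(ltnW tk) //.
rewrite -addn1 iotaD map_cat /= cats1; congr rcons.
by have := polP (history mu G pol t); rewrite size_history tk.
Qed.

(** The first [2 * k] arms read as two copies of 0, ..., k - 1, each containing [i] once. *)
Lemma forced_pulls t i : (2 * k <= t)%N -> (2 <= pulls (arms mu G pol t) i)%N.
Proof.
elim: t => [|t IHt]; first by have := ltn_ord i; lia.
rewrite leq_eqVlt => /orP[/eqP tk|]; last first.
  by rewrite ltnS => /IHt H; rewrite arms_S pulls_rcons; lia.
rewrite -tk.
have -> : pulls (arms mu G pol (2 * k)) i =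
    count_mem (val i) [seq val j | j <- arms mu G pol (2 * k)].
  by rewrite count_map; apply: eq_count => j /=; rewrite -val_eqE.
rewrite forced_arms // mul2n -addnn iotaD map_cat count_cat add0n.
have modk : [seq (s %% k)%N | s <- iota 0 k] = iota 0 k.
  by apply: map_id_in => s; rewrite mem_iota => /andP[_ sk]; rewrite modn_small.
have -> : [seq (s %% k)%N | s <- iota k k] = iota 0 k.
  have -> : iota k k = [seq (k + s)%N | s <- iota 0 k] by rewrite -iotaDl addn0.
  by rewrite -map_comp -[RHS]modk; apply: eq_map => s /=; rewrite modnDl.
by rewrite modk !count_uniq_mem ?iota_uniq // mem_iota ltn_ord.
Qed.

(** The argmax rule enters here: [mu j n] is at most [mu j t.+1], then the index of [j], then the
    index of [i]. As [n] is any trigger count up to [t.+1], the competitor's history need not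
    resemble that of [pol]. *)
Lemma gap_bound t i j n q T :
  i = pol (history mu G pol t) -> 0 <= q <= 1 -> (2 * k <= t < T)%N ->
  (0 < n <= t.+1)%N ->
  mu j n - mu i (triggers G (rcons (arms mu G pol t) i) i) <=
  T%:R `^ q * max_increment q (pulls (arms mu G pol t) i).-1.
Proof.
move=> iE q01 /andP[kt tT] n_t.
set h := history mu G pol t in iE *; set a := arms mu G pol t.
have szh : size h = t by apply: size_history.
have sza : size a = t by apply: size_arms.
have N2 l : (2 <= pulls a l)%N by apply: forced_pulls.
have indexE l : let N := pulls a l in let tI := internal_time G a l in
    ucb_index G h l = mu l (tI N) + (t.+1%:R - (tI N)%:R) *
      ((mu l (tI N) - mu l (tI N.-1)) / ((tI N)%:R - (tI N.-1)%:R)).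
  rewrite /ucb_index szh -/(arms mu G pol t) -/a.
  by rewrite !observed_rewardE -/a //; have := N2 l; lia.
(* Two forced pulls make the penultimate pull exist, so the chord has two distinct positive
   endpoints. *)
have tI_lt l : (0 < internal_time G a l (pulls a l).-1
    < internal_time G a l (pulls a l))%N.
  have := N2 l => N2l; rewrite internal_time_mono //; last by lia.
  have := internal_time_ge G a l (Gdiag l) (pulls a l).-1; lia.
have tI_le l : (internal_time G a l (pulls a l) <= t)%N.
  by apply: leq_trans (internal_time_le G a l _) _; rewrite -sza count_size.
have chord l := chord_bounds (mu l) _ _ t.+1 (gamma_noninc l)
  (andP (tI_lt l)).1 (andP (tI_lt l)).2 (leqW (tI_le l)).
have jmax : ucb_index G h j <= ucb_index G h i.
  by have := polP h; rewrite szh ltnNge kt iE; apply.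
have [gap1 _] := chord j; have [_ slope] := chord i.
move: jmax; rewrite !indexE => jmax.
have jn : mu j n <= mu j t.+1 by apply: mu_mono.
have [tI0 tIlt] := andP (tI_lt i).
set x := mu i (triggers _ _ _).
(* The present trigger count of [i] is at least the internal time of its last pull, so [x] absorbs
   the base value of the index and only the slope term is left. *)
have xge : mu i (internal_time G a i (pulls a i)) <= x.
  apply: mu_mono; rewrite (leq_trans _ tIlt) //= triggers_rcons.
  by apply: leq_trans (internal_time_le G a i _) (leq_addr _ _).
have gam : gamma mu i (internal_time G a i (pulls a i).-1) <=
    gamma mu i (pulls a i).-1.
  apply: gamma_noninc; have := N2 i => N2i.
  by rewrite internal_time_ge //; lia.
have g0 : 0 <= gamma mu i (pulls a i).-1.
  by apply: mu_rising.1; have := N2 i; lia.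
have gapT : mu j n - x <= T%:R * gamma mu i (pulls a i).-1.
  rewrite lerBlDr (le_trans jn) // (le_trans gap1) // (le_trans jmax) //.
  rewrite addrC lerD // ler_pM //.
  - by rewrite subr_ge0 ler_nat (leq_trans (tI_le i)).
  - by rewrite divr_ge0 ?subr_ge0 ?ler_nat ?mu_mono ?tI0 ?(ltnW tIlt).
  - by rewrite lerBlDr ler_wpDr // ler_nat.
  - exact: le_trans slope gam.
have gap_1 : mu j n - x <= 1.
  have /andP[_ j1] : 0 <= mu j n <= 1 by apply: mu01; case/andP: n_t.
  by have /andP[x0 _] := reward_bounds pol t; rewrite -iE -/x in x0; lra.
apply: le_trans (le_powR_of_le1 _ _ q q01 _ gap_1 gapT) _.
  by rewrite mulr_ge0.
by rewrite powRM // ler_wpM2l ?powR_ge0 //; apply: le_bigmax.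
Qed.

(** Compares the two policies round by round: after the forced phase, each round's gap is charged to
    the arm that [pol] plays. *)
Lemma J_comparison pol' t q T : 0 <= q <= 1 -> (2 * k <= t <= T)%N ->
  J mu G pol' t <= J mu G pol t + (2 * k)%:R +
    T%:R `^ q * \sum_i Upsilon mu (pulls (arms mu G pol t) i).-1 q.
Proof.
move=> q01; elim: t => [|t IHt].
  move=> _; rewrite /J !big_nil add0r addr_ge0 // mulr_ge0 ?powR_ge0 //.
  by apply: sumr_ge0 => i _; apply: Upsilon_ge0.
(* At the end of the forced phase both totals lie between 0 and [2 * k]. *)
move=> /andP[]; rewrite leq_eqVlt => /orP[/eqP tk _|].
  have /andP[_ le1] := J_bounds pol' t.+1; have /andP[ge1 _] := J_bounds pol t.+1.
  apply: (le_trans le1); rewrite tk -[X in X <= _]add0r -[X in X <= _]addr0.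
  rewrite !lerD // mulr_ge0 ?powR_ge0 //.
  by apply: sumr_ge0 => i _; apply: Upsilon_ge0.
rewrite ltnS => kt tT; have {}IHt := IHt (introT andP (conj kt (ltnW tT))).
rewrite !J_S; set i := pol _; set j := pol' _.
have nt : (0 < triggers G (rcons (arms mu G pol' t) j) j <= t.+1)%N.
  by rewrite triggers_rcons Gdiag addn1 /= ltnS -{2}(size_arms pol' t) count_size.
have := gap_bound t i j _ q T erefl q01 (introT andP (conj kt tT)) nt.
set a := arms mu G pol t in IHt *.
have N2 : (2 <= pulls a i)%N by apply: forced_pulls.
rewrite arms_S -/i -/a.
(* Only the summand of the played arm changes, and it gains exactly the term supplied by
   [gap_bound]. *)
have -> : \sum_l Upsilon mu (pulls (rcons a i) l).-1 q =
    Upsilon mu (pulls a i) q + \sum_(l | l != i) Upsilon mu (pulls a l).-1 q.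
  rewrite (bigD1 i) //= pulls_rcons eqxx addn1; congr (_ + _).
  by apply: eq_bigr => l li; rewrite pulls_rcons eq_sym (negbTE li) addn0.
have -> : Upsilon mu (pulls a i) q =
    Upsilon mu (pulls a i).-1 q + max_increment q (pulls a i).-1.
  rewrite {1}/Upsilon -[in X in \sum_(_ <= _ < X) _](prednK (ltnW N2)).
  by rewrite big_nat_recr //; lia.
by move: IHt; rewrite (bigD1 i) //= !mulrDr; lra.
Qed.

Lemma regret_le T q : 0 <= q <= 1 -> (2 * k <= T)%N ->
  regret mu G pol T <= (2 * k)%:R +
    T%:R `^ q * \sum_i Upsilon mu (pulls (arms mu G pol T) i).-1 q.
Proof.
move=> q01 kT; rewrite /regret lerBlDl addrA; apply: ge_sup.
  by exists (J mu G pol T), pol.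
by move=> _ [pol' _ <-]; apply: J_comparison; rewrite // kT leqnn.
Qed.

Lemma regret_le_short T : (T < 2 * k)%N -> regret mu G pol T <= (2 * k)%:R.
Proof.
move=> Tk; rewrite /regret lerBlDl; apply: ge_sup.
  by exists (J mu G pol T), pol.
move=> _ [pol' _ <-].
have /andP[_ le1] := J_bounds pol' T; have /andP[ge1 _] := J_bounds pol T.
have le2 : T%:R <= (2 * k)%:R :> R by rewrite ler_nat ltnW.
by lra.
Qed.

(** * From pulls of arms to pulls of cliques *)

Section Cliques.
Variable P : {set {set 'I_k}}.
Implicit Types (C : {set 'I_k}).
Hypothesis partP : finset.partition P [set: 'I_k].

Lemma clique_gt0 C : C \in P -> (0 < #|C|)%N.
Proof.
case/and3P: partP => _ _ P0 CP; rewrite card_gt0.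
by apply: contraNneq P0 => <-.
Qed.

Lemma ceil_ratio (m n : nat) : (0 < n)%N ->
  (m <= n * `|Num.ceil (m%:R / n%:R : R)|)%N.
Proof.
move=> n0; rewrite -(ler_nat R) natrM mulrC -ler_pdivrMr ?ltr0n //.
apply: le_trans (ceil_ge _) _; rewrite -[X in _ <= X]/((Posz _)%:~R) ler_int.
by rewrite abszE ler_norm.
Qed.

Lemma clique_pulls_ge T C : (2 * k <= T)%N ->
  (2 * #|C| <= clique_pulls (arms mu G pol T) C)%N.
Proof.
move=> kT; rewrite mulnC -sum_nat_const.
by apply: leq_sum => i _; apply: forced_pulls.
Qed.

(** Guarantees that the sum in [clique_Upsilon] contains its term at 1. *)
Lemma clique_ceil_ge2 T C : (2 * k <= T)%N -> C \in P ->
  (2 <= `|Num.ceil ((clique_pulls (arms mu G pol T) C)%:R / #|C|%:R : R)|)%N.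
Proof.
move=> kT CP; have C0 := clique_gt0 C CP.
rewrite -(leq_pmul2l C0) (leq_trans _ (ceil_ratio _ _ C0)) // mulnC.
exact: clique_pulls_ge.
Qed.

(** [jensen_sum] inside each clique, with the ceiling of the average number of pulls as [M]. *)
Lemma sum_Upsilon_cliques T q : (2 * k <= T)%N -> 0 <= q ->
  \sum_i Upsilon mu (pulls (arms mu G pol T) i).-1 q <=
  \sum_(C in P) #|C|%:R * clique_Upsilon mu (arms mu G pol T) C q.
Proof.
move=> kT q0; set a := arms mu G pol T.
have -> : \sum_i Upsilon mu (pulls a i).-1 q =
    \sum_(i in [set: 'I_k]) Upsilon mu (pulls a i).-1 q.
  by apply: eq_bigl => i; rewrite inE.
rewrite (set_partition_big P partP) /=; apply: ler_sum => C CP.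
have M2 := clique_ceil_ge2 T C kT CP; have C0 := clique_gt0 C CP.
rewrite /clique_Upsilon /Upsilon; apply: jensen_sum.
- by move=> m n; apply: max_increment_noninc.
- by move=> n; apply: max_increment_ge0.
- by move=> i; have := forced_pulls T i kT; rewrite -/a; lia.
- exact: leq_trans M2.
apply: leq_trans (ceil_ratio _ _ C0).
by apply: leq_sum => i _; apply: leq_pred.
Qed.

Lemma clique_sum_ge0 a q : 0 <= \sum_(C in P) #|C|%:R * clique_Upsilon mu a C q.
Proof. by apply: sumr_ge0 => C _; rewrite mulr_ge0 ?Upsilon_ge0. Qed.

Lemma le_rate a T q :
  T%:R `^ q * (\sum_(C in P) #|C|%:R * clique_Upsilon mu a C q) <= rate mu P a T q.
Proof.
by rewrite lerDl; apply: sumr_ge0 => C _; rewrite !mulr_ge0 ?powR_ge0.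
Qed.

Lemma regret_le_rate T q : 0 <= q <= 1 ->
  regret mu G pol T <= (2 * k)%:R + rate mu P (arms mu G pol T) T q.
Proof.
move=> q01; have [kT|Tk] := leqP (2 * k) T; last first.
  apply: le_trans (regret_le_short T Tk) _; rewrite lerDl.
  by apply: le_trans (le_rate _ _ _); rewrite mulr_ge0 ?powR_ge0 ?clique_sum_ge0.
apply: le_trans (regret_le T q q01 kT) _; rewrite lerD2l.
apply: le_trans (le_rate _ _ _); rewrite ler_wpM2l ?powR_ge0 //.
by case/andP: q01 => q0 _; apply: sum_Upsilon_cliques.
Qed.

(** Clique sizes add up to [k], and the term at 1 of each [clique_Upsilon], multiplied by the [q]-th
    power of [T], is at least 1. *)
Lemma forced_cost_le_rate T q i : 0 <= q -> (2 * k <= T)%N ->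
  1 <= T%:R * gamma mu i 1 -> k%:R <= rate mu P (arms mu G pol T) T q.
Proof.
move=> q0 kT Tg; apply: le_trans (le_rate _ _ _); set a := arms mu G pol T.
have g0 : 0 <= gamma mu i 1 by apply: mu_rising.1.
have one : 1 <= T%:R `^ q * max_increment q 1.
  apply: (@le_trans _ _ (T%:R `^ q * gamma mu i 1 `^ q)).
    by rewrite -powRM //; exact: powR_ge1.
  by rewrite ler_wpM2l ?powR_ge0 //; apply: le_bigmax.
have -> : k%:R = \sum_(C in P) #|C|%:R :> R.
  by rewrite -natr_sum -(card_partition partP) cardsT card_ord.
rewrite mulr_sumr; apply: ler_sum => C CP.
rewrite mulrCA -[X in X <= _]mulr1 ler_wpM2l // (le_trans one) //.
rewrite ler_wpM2l ?powR_ge0 // /clique_Upsilon /Upsilon big_ltn.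
  by rewrite lerDl; apply: sumr_ge0 => n _; apply: max_increment_ge0.
exact: clique_ceil_ge2.
Qed.

Lemma le_regret_rate T x :
  (forall q, 0 <= q <= 1 -> x <= rate mu P (arms mu G pol T) T q) ->
  x <= regret_rate mu G P pol T.
Proof.
move=> xle; apply: lb_le_inf; last by move=> _ [q q01 <-]; apply: xle.
by exists (rate mu P (arms mu G pol T) T 0), 0 => //=; rewrite lexx ler01.
Qed.

End Cliques.
End Algorithm.
End Play.

Theorem theorem3 (R : realType) :
  exists (c : R) (p : nat), 0 < c /\
  forall (k kt T : nat) (G : 'M[bool]_k) (P : {set {set 'I_k}})
    (mu : 'I_k -> nat -> R) (pol : policy R k),
  connectivity G -> block_diagonal kt G P ->
  unit_rewards mu -> rising mu -> DR_BD_UB G pol ->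
  (* every instance and horizon, with the cost of the 2k forced pulls *)
  regret mu G pol T <= (2 * k)%:R + soft_O c p T (regret_rate mu G P pol T) /\
  (* no additive term once the 2k forced pulls are over and some initial
     increment is at least 1/T *)
  ((2 * k <= T)%N -> (exists i, 1 <= T%:R * gamma mu i 1) ->
   regret mu G pol T <= soft_O c p T (regret_rate mu G P pol T)).
Proof.
(* One copy of the rate pays for the gaps and two for the [2 * k] forced pulls; no logarithm
   arises. *)
exists 3, 0%N; split=> // k kt T G P mu pol [_ Gdiag] [partP _ _] mu01 rising polP.
rewrite /soft_O expr0 mulr1.
have upper : regret mu G pol T <= (2 * k)%:R + regret_rate mu G P pol T.
  rewrite -lerBlDl; apply: le_regret_rate => q q01; rewrite lerBlDl.
  exact: regret_le_rate.
split.
  (* Enlarging the constant from 1 to 3 requires the rate to be nonnegative. *)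
  apply: le_trans upper _; rewrite lerD2l ler_peMl //; last by lra.
  apply: le_regret_rate => q _; apply: le_trans; last by apply: le_rate.
  by rewrite mulr_ge0 ?powR_ge0 ?clique_sum_ge0.
move=> kT [i Ti]; apply: le_trans upper _.
have : k%:R <= regret_rate mu G P pol T.
  apply: le_regret_rate => q /andP[q0 _]; exact: forced_cost_le_rate Ti.
by rewrite natrM; lra.
Qed.
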